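(* Let $\kappa$ be a regular uncountable cardinal and $\lambda>\kappa$ a cardinal. Suppose $\kappa$ is weakly compact. Then $H^+\xrightarrow{\kappa}(H^+)^2$ for every ideal $H$ on $P_\kappa(\lambda)$ such that $\mathrm{cof}(H)<\mathbf{cov}(\mathbf{M}_{\kappa,\kappa})$.
   Context: For a cardinal $\mu$ and a set $A$, $P_\mu(A)=\{a\subseteq A:|a|<\mu\}$. An ideal on an infinite set $S$ is a collection $K$ of subsets of $S$ containing all singletons, closed under subsets and finite unions, with $S\notin K$; $K^+=P(S)\setminus K$; $\mathrm{cof}(K)$ is the least cardinality of an $X\subseteq K$ with $K=\bigcup_{A\in X}P(A)$. $I_{\kappa,\lambda}$ is the set of all $A\subseteq P_\kappa(\lambda)$ such that $A\cap\{b\in P_\kappa(\lambda):a\subseteq b\}=\emptyset$ for some $a\in P_\kappa(\lambda)$. ''Ideal on $P_\kappa(\lambda)$'' always means an ideal $H$ on $P_\kappa(\lambda)$ that is $\kappa$-complete (closed under unions of fewer than $\kappa$ members) and fine ($I_{\kappa,\lambda}\subseteq H$). $\kappa$ is weakly compact if for every $f:\{(\xi,\eta)\in\kappa\times\kappa:\xi<\eta\}\to2$ there is $A\subseteq\kappa$ of order type $\kappa$ such that $f$ is constant on $\{(\xi,\eta)\in A\times A:\xi<\eta\}$. For $A\subseteq P_\kappa(\lambda)$, $[A]^2_\kappa=\{(\bigcup(a\cap\kappa),b):a,b\in A,\ \bigcup(a\cap\kappa)<\bigcup(b\cap\kappa)\}$. For an ideal $H$ on $P_\kappa(\lambda)$,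 $H^+\xrightarrow{\kappa}(H^+)^2$ means: for every $F:[P_\kappa(\lambda)]^2_\kappa\to2$ and every $A\in H^+$ there is $B\in H^+\cap P(A)$ such that $F$ is constant on $[B]^2_\kappa$. $\mathbf{cov}(\mathbf{M}_{\kappa,\kappa})$: give ${}^\kappa2$ the topology whose basic open sets are $\emptyset$ and $O_s=\{f\in{}^\kappa2:s\subseteq f\}$ for $s\in\bigcup\{{}^a2:a\in P_\kappa(\kappa)\}$. $\mathbf{M}_{\kappa,\kappa}$ is the set of all $W\subseteq{}^\kappa2$ such that $W\cap\bigcap X=\emptyset$ for some collection $X$ of dense open sets with $0<|X|\le\kappa$. $\mathbf{cov}(\mathbf{M}_{\kappa,\kappa})$ is the least cardinality of a $Y\subseteq\mathbf{M}_{\kappa,\kappa}$ with $\bigcup Y={}^\kappa2$. *)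

(* Defs.v *)
From mathcomp Require Import all_boot all_order.
From mathcomp Require Import wochoice all_classical.

Set Implicit Arguments.
Unset Strict Implicit.
Unset Printing Implicit Defensive.

Import Order.TTheory.

Local Open Scope classical_set_scope.
Local Open Scope card_scope.
Local Open Scope order_scope.

(* A cardinal is represented by any set of that cardinality.
   An ordinal is represented either by a well-ordered type (the ordinal
   [lambda] is the set of all points of the type) or by a point of such a type,
   identified with the set of its predecessors, as von Neumann ordinals are.
   Thus a cardinal kappa < lambda is a point of lambda. *)

Definition card_lt (T U : Type) (A : set T) (B : set U) : Prop :=
  A #<= B /\ ~ (A #= B).

(* |X| is the least cardinality of a member of P *)
Definition least_card (T : Type) (P : set (set T)) (X : set T) : Prop :=
  P X /\ forall Y, P Y -> X #<= Y.

(* (least cardinality of a member of P) < (least cardinality of a member of Q) *)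
Definition least_card_lt (T U : Type) (P : set (set T)) (Q : set (set U)) : Prop :=
  exists X Y, [/\ least_card P X, least_card Q Y & card_lt X Y].

(* P_mu(A), for mu the cardinality of M *)
Definition small_subsets (T U : Type) (M : set U) (A : set T) : set (set T) :=
  [set a | a `<=` A /\ card_lt a M].

Definition powerset_of (T : Type) (A : set T) : set (set T) := [set B | B `<=` A].

(** Ordinals and cardinals *)

Definition segment d (L : orderType d) (x : L) : set L := [set y | y < x].

(* an initial segment A of a well-ordered set, seen as an ordinal, is a cardinal *)
Definition is_cardinal d (L : orderType d) (A : set L) : Prop :=
  forall x, A x -> card_lt (segment x) A.

Definition cofinal_in d (L : orderType d) (A B : set L) : Prop :=
  B `<=` A /\ forall x, A x -> exists2 y, B y & x <= y.

(* kappa is an infinite cardinal and cf(kappa) = kappa *)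
Definition regular_cardinal d (L : orderType d) (kappa : L) : Prop :=
  [/\ is_cardinal (segment kappa), infinite_set (segment kappa) &
      least_card (cofinal_in (segment kappa)) (segment kappa)].

Definition same_order_type d (L : orderType d) (A B : set L) : Prop :=
  exists2 g : L -> L, set_bij A B g & {in A &, {homo g : x y / x < y}}.

(* Functions into 2 defined on a subset of a type are given by total functions,
   whose values outside of the subset are irrelevant. *)
Definition constant_on (T : Type) (D : set T) (F : T -> bool) : Prop :=
  exists c, forall x, D x -> F x = c.

Definition weakly_compact d (L : orderType d) (kappa : L) : Prop :=
  forall f : L * L -> bool, exists A : set L,
    [/\ A `<=` segment kappa, same_order_type A (segment kappa) &
        constant_on [set p | [/\ A p.1, A p.2 & p.1 < p.2]] f].

(** Ideals *)

Definition is_ideal (T : Type) (S : set T) (K : set (set T)) : Prop :=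
  infinite_set S /\
  [/\ K `<=` powerset_of S,
      forall x, S x -> K [set x],
      forall A B, K A -> B `<=` A -> K B,
      forall A B, K A -> K B -> K (A `|` B) &
      ~ K S].

Definition positive (T : Type) (S : set T) (K : set (set T)) : set (set T) :=
  powerset_of S `\` K.

(* [least_card (cofinal_families K) X] means that |X| = cof(K) *)
Definition cofinal_families (T : Type) (K : set (set T)) : set (set (set T)) :=
  [set X | X `<=` K /\ K = \bigcup_(A in X) powerset_of A].

Section Pkl.
Context d (lambda : orderType d) (kappa : lambda).

Definition Pkl : set (set lambda) := small_subsets (segment kappa) [set: lambda].

Definition Ikl : set (set (set lambda)) :=
  [set A | A `<=` Pkl /\
    exists2 a, Pkl a & A `&` [set b | Pkl b /\ a `<=` b] = set0].

Definition kappa_complete (H : set (set (set lambda))) : Prop :=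
  forall X, X `<=` H -> card_lt X (segment kappa) -> H (\bigcup_(A in X) A).

Definition ideal_on_Pkl (H : set (set (set lambda))) : Prop :=
  [/\ is_ideal Pkl H, kappa_complete H & Ikl `<=` H].

(* the ordinal \bigcup (a \cap kappa); see [cap_unionE] *)
Definition cap_union (a : set lambda) : lambda :=
  xget kappa [set s | segment s =
    \bigcup_(x in a `&` segment kappa) segment x].

(* [A]^2_kappa *)
Definition kpairs (A : set (set lambda)) : set (lambda * set lambda) :=
  [set p | exists a b, [/\ A a, A b, cap_union a < cap_union b &
                           p = (cap_union a, b)]].

(* H^+ --kappa--> (H^+)^2 *)
Definition kappa_arrow (H : set (set (set lambda))) : Prop :=
  forall (F : lambda * set lambda -> bool) A, positive Pkl H A ->
    exists B, [/\ positive Pkl H B, B `<=` A & constant_on (kpairs B) F].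

Lemma cap_unionE (a : set lambda) : well_order (<=%O : rel lambda) ->
  segment (cap_union a) = \bigcup_(x in a `&` segment kappa) segment x.
Proof.
move=> wo; rewrite /cap_union; case: xgetP => [s _ //|no]; exfalso.
set U := \bigcup_(x in _) _ in no.
have Uk : ~ U kappa.
  by case=> x [_ xk] kx; have := lt_trans (xk : x < kappa) kx; rewrite ltxx.
have [|s [[/asboolP Us lbs] _]] := wo [pred x | `[< ~ U x >]].
  by exists kappa; apply/asboolP.
apply: (no s); apply/seteqP; split=> y.
- move=> ys; apply: contrapT => Uy.
  have : s <= y by apply: lbs; apply/asboolP.
  by rewrite leNgt (ys : y < s).
- move=> [x ax yx]; rewrite /segment /= ltNge; apply/negP => sy.
  by apply: Us; exists x => //; apply: le_lt_trans sy yx.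
Qed.

End Pkl.

(** The ideal of meager sets on ^kappa 2, for kappa the cardinality of K *)

Section Meager.
Variable K : Type.

(* O_s, for s the restriction to a of the function [s] *)
Definition basic_nbhd (a : set K) (s : K -> bool) : set (K -> bool) :=
  [set f | forall x, a x -> f x = s x].

Definition basic_open : set (set (K -> bool)) :=
  [set W | W = set0 \/ exists a s,
     small_subsets [set: K] [set: K] a /\ W = basic_nbhd a s].

Definition box_open : set (set (K -> bool)) :=
  [set W | exists2 C, C `<=` basic_open & W = \bigcup_(O in C) O].

Definition box_dense (D : set (K -> bool)) : Prop :=
  forall O, O !=set0 -> box_open O -> O `&` D !=set0.

Definition meager : set (set (K -> bool)) :=
  [set W | exists X : set (set (K -> bool)),
    [/\ forall D, X D -> box_open D /\ box_dense D,
        X !=set0, X #<= [set: K] & W `&` \bigcap_(D in X) D = set0]].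

(* [least_card meager_covers Y] means that |Y| = cov(M_{kappa,kappa}) *)
Definition meager_covers : set (set (set (K -> bool))) :=
  [set Y | Y `<=` meager /\ \bigcup_(W in Y) W = [set: K -> bool]].

End Meager.

Arguments basic_open : clear implicits.
Arguments box_open : clear implicits.
Arguments meager : clear implicits.
Arguments meager_covers : clear implicits.

(* Main.v *)
(* Write s(b) for the ordinal bigcup (b cap kappa). Weak compactness of kappa
   makes every kappa-sequence in 2^kappa have a subsequence of length kappa that
   converges in the (< kappa)-box topology. Together with kappa-completeness of H
   this gives h : kappa -> 2 such that for each x < kappa the set of b in A with
   F(y, b) = h(y) for all y < x is positive, and then a colour i such that these
   sets stay positive when intersected with {b | h(s(b)) = i}.  For g in 2^kappa,
   let B_g be the set of the b in A such that h(s(b)) = i, g(s(b)) = 1, and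
   F(y, b) = i for all y < s(b) with g(y) = 1 and h(y) = i. Then F has the constant
   value i on [B_g]^2. For D in H, the g with B_g not included in D form a dense
   open set, so if D ranges over a cofinal family with fewer than cov(M) members
   some g belongs to all these sets, and B_g is positive. *)

Require Import Defs.
From mathcomp Require Import all_boot all_order.
From mathcomp Require Import wochoice all_classical.

Local Open Scope classical_set_scope.

Set Implicit Arguments.
Unset Strict Implicit.
Unset Printing Implicit Defensive.
Import Order.TTheory.
Local Open Scope card_scope.
Local Open Scope order_scope.

(** * Comparison of cardinalities *)

Lemma card_le_lt_trans (T U V : Type) (A : set T) (B : set U) (C : set V) :
  A #<= B -> card_lt B C -> card_lt A C.
Proof.
move=> AB [BC nBC]; split; first exact: card_le_trans AB BC.
move=> AC; apply: nBC; rewrite card_eq_le BC /=.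
by rewrite -(card_le_eql AC).
Qed.

Lemma card_lt_le_trans (T U V : Type) (A : set T) (B : set U) (C : set V) :
  card_lt A B -> B #<= C -> card_lt A C.
Proof.
move=> [AB nAB] BC; split; first exact: card_le_trans AB BC.
move=> AC; apply: nAB; rewrite card_eq_le AB /=.
by rewrite (card_le_eqr AC).
Qed.

Lemma card_lt_nge (T U : Type) (A : set T) (B : set U) :
  card_lt A B -> ~ (B #<= A).
Proof. by move=> [AB nAB] BA; apply: nAB; rewrite card_eq_le AB BA. Qed.

Lemma finite_card_lt (T U : Type) (A : set T) (B : set U) :
  finite_set A -> infinite_set B -> card_lt A B.
Proof.
move=> finA infB; split; last first.
  by move=> AB; apply: infB; apply: card_le_finite finA; rewrite (card_le_eqr AB).
have /infiniteP natB := infB; apply: card_le_trans natB.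
exact: finite_set_countable.
Qed.

(** * Well-founded recursion *)

Lemma well_order_wf d (L : orderType d) : well_order (<=%O : rel L) ->
  well_founded (fun x y : L => x < y).
Proof.
move=> wo; apply: contrapT => nwf.
have [x0 nx0] : exists x, ~ Acc (fun x y : L => x < y) x.
  apply: contrapT => nex; apply: nwf => x.
  by apply: contrapT => nx; apply: nex; exists x.
have [|m [[/asboolP nm lbm] _]] := wo [pred x | `[< ~ Acc (fun x y : L => x < y) x >]].
  by exists x0; apply/asboolP.
apply: nm; constructor => y ym; apply: contrapT => ny.
have : m <= y by apply: lbm; apply/asboolP.
by rewrite leNgt ym.
Qed.

(** Recursion with choice: since every [f] is allowed in the hypothesis, it applies to the values
    chosen so far. [u0] is the default outside [K]. *)
Lemma wf_choice (T : Type) (U : choiceType) (lt : T -> T -> Prop)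
    (u0 : U) (K : set T) (A : set U) (R : U -> U -> Prop) :
  well_founded lt ->
  (forall x (f : T -> U), K x -> exists2 u, A u & forall y, lt y x -> R (f y) u) ->
  exists f : T -> U, forall x, K x -> A (f x) /\ forall y, lt y x -> R (f y) (f x).
Proof.
move=> wf ex.
pose body x (rec : forall y, lt y x -> U) :=
  xget u0 [set u | A u /\ forall y (yx : lt y x), R (rec y yx) u].
pose f := Fix wf (fun=> U) body.
have fE x : f x = xget u0 [set u | A u /\ forall y (yx : lt y x), R (f y) u].
  rewrite /f Fix_eq // => y g h gh; rewrite /body.
  congr xget; apply/funext => u /=; apply/propext.
  by split=> -[Au Ru]; split=> // z zy;
    [rewrite -gh | rewrite gh].
exists f => x Kx; rewrite [f x]fE.
by case: xgetP => [u _ //|no]; have [u Au Ru] := ex x f Kx; case: (no u).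
Qed.

(** * Open dense sets in the box topology *)

Lemma basic_nbhd_open (T : Type) (W : set (T -> bool)) :
  (forall f, W f -> exists2 a, small_subsets [set: T] [set: T] a &
    basic_nbhd a f `<=` W) ->
  box_open T W.
Proof.
move=> nb; exists [set O | basic_open T O /\ O `<=` W]; first by move=> O [].
apply/seteqP; split=> [f Wf|f [O [_ OW]]]; last exact: OW.
have [a small aW] := nb f Wf.
by exists (basic_nbhd a f) => //; split=> //; right; exists a, f.
Qed.

Lemma basic_nbhd_dense (T : Type) (W : set (T -> bool)) :
  (forall a s, small_subsets [set: T] [set: T] a -> basic_nbhd a s `&` W !=set0) ->
  box_dense W.
Proof.
move=> nb O [f Of] [C Cb OE]; move: Of; rewrite OE => -[O' CO' Of].
have [E|[a [s [small E]]]] := Cb _ CO'; first by rewrite E in Of.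
have [g [ag Wg]] := nb a s small.
by exists g; split=> //; exists O' => //; rewrite E.
Qed.

Lemma open_dense_setC_meager (T : Type) (W : set (T -> bool)) : T ->
  box_open T W -> box_dense W -> meager T (~` W).
Proof.
move=> t oW dW; exists [set W]; split; first by move=> D ->.
- by exists W.
- by apply/pcard_surjP; exists (fun=> W) => _ ->; exists t.
- by apply/seteqP; split=> // f [nWf /(_ W erefl)].
Qed.

(** If the intersection were empty, the complements would be a cover by at most |[X]| meager sets,
    against the minimality of [Y]. *)
Lemma open_dense_bigcap_nonempty (T U : Type) (X : set U) (Y : set (set (T -> bool)))
    (W : U -> set (T -> bool)) : T ->
  least_card (meager_covers T) Y -> card_lt X Y ->
  (forall D, X D -> box_open T (W D) /\ box_dense (W D)) ->
  \bigcap_(D in X) W D !=set0.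
Proof.
move=> t [_ least] XY oW; apply/set0P/negP => /eqP W0.
apply: card_lt_nge XY _; apply: card_le_trans (card_image_le (fun D => ~` W D) X).
apply: least; split.
  by move=> _ [D XD <-]; have [] := oW D XD; apply: open_dense_setC_meager.
by rewrite bigcup_image -setC_bigcap W0 setC0.
Qed.

(** * Consequences of regularity *)

Section RegularCardinal.
Context d (lambda : orderType d) (kappa : lambda).
Hypothesis lambda_wo : well_order (<=%O : rel lambda).
Hypothesis kappa_regular : regular_cardinal kappa.

(** An unbounded image would be cofinal in [kappa], hence of size at least [kappa] by regularity. *)
Lemma small_family_bounded (U : Type) (a : set U) (f : U -> lambda) :
  card_lt a (segment kappa) -> (forall x, a x -> f x < kappa) ->
  exists2 g, g < kappa & forall x, a x -> f x <= g.
Proof.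
move=> small fk; have [_ _ [_ least]] := kappa_regular.
apply: contrapT => nb.
have : segment kappa #<= f @` a.
  apply: least; split; first by move=> _ [x ax <-]; apply: fk.
  move=> x xk; apply: contrapT => nex; apply: nb; exists x => // y ay.
  rewrite leNgt; apply/negP => xy; apply: nex.
  by exists (f y); [exists y | exact: ltW].
move/card_le_trans => /(_ _ _ (card_image_le f a)).
exact: card_lt_nge.
Qed.

Lemma segment_card_lt x : x < kappa -> card_lt (segment x) (segment kappa).
Proof. by have [cd _ _] := kappa_regular; apply: cd. Qed.

Lemma choose_bounded (x : lambda) (P : lambda -> lambda -> Prop) : x < kappa ->
  (forall y g g', g <= g' -> P y g -> P y g') ->
  (forall y, y < x -> exists2 g, g < kappa & P y g) ->
  exists2 g, g < kappa & forall y, y < x -> P y g.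
Proof.
move=> xk mono ex.
have /choice[f fP] : forall y, exists g, y < x -> g < kappa /\ P y g.
  move=> y; have [yx|] := ltP y x; last by exists x.
  by have [g] := ex y yx; exists g.
have [g gk fg] := @small_family_bounded _ (segment x) f (segment_card_lt xk)
  (fun y yx => (fP y yx).1).
by exists g => // y yx; apply: mono (fg y yx) (fP y yx).2.
Qed.

Lemma regular_lt_next x : x < kappa -> exists2 y, x < y & y < kappa.
Proof.
move=> xk; have [_ infk [_ least]] := kappa_regular.
apply: contrapT => nex; apply: infk.
apply: card_le_finite (finite_set1 x); apply: least; split.
  by move=> _ ->.
move=> y yk; exists x => //; rewrite leNgt; apply/negP => xy.
by apply: nex; exists y.
Qed.

Lemma initial_card_lt x : x < kappa -> card_lt [set y | y <= x] (segment kappa).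
Proof.
move=> xk; have [y xy yk] := regular_lt_next xk.
apply: card_le_lt_trans (segment_card_lt yk).
by apply: subset_card_le => z /= zx; apply: le_lt_trans zx xy.
Qed.

(** * Convergent subsequences from weak compactness *)

Lemma order_type_unbounded (A : set lambda) x : same_order_type A (segment kappa) ->
  x < kappa -> exists2 y, A y & x < y.
Proof.
move=> [g [fg ig sg] _] xk; apply: contrapT => nex.
apply: card_lt_nge (initial_card_lt xk) _.
have : segment kappa #<= A.
  apply: card_le_trans (card_image_le g A).
  exact: subset_card_le.
move/card_le_trans; apply; apply: subset_card_le => y Ay /=.
by rewrite leNgt; apply/negP => xy; apply: nex; exists y.
Qed.

(* The colouring compares sequences lexicographically. Along a homogeneous set
   each coordinate is eventually monotone, hence eventually constant, as soon as
   all smaller coordinates are. *)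
Lemma weakly_compact_convergence (t : lambda -> lambda -> bool) :
  weakly_compact kappa ->
  exists (A : set lambda) (h : lambda -> bool),
    [/\ A `<=` segment kappa, forall x, x < kappa -> exists2 y, A y & x < y &
      forall x, x < kappa -> exists2 g, g < kappa &
        forall z, A z -> g <= z -> forall y, y < x -> t z y = h y].
Proof.
move=> wc.
pose lex p := exists y, [/\ t p.1 y = false, t p.2 y = true &
  forall z, z < y -> t p.1 z = t p.2 z].
have [A [Ak otA [c cP]]] := wc (fun p => `[< lex p >]).
have unbA x : x < kappa -> exists2 y, A y & x < y by exact: order_type_unbounded.
pose conv x v g := forall z, A z -> g <= z -> t z x = v.
have conv_ex x : x < kappa -> exists v, exists2 g, g < kappa & conv x v g.
  elim/(well_founded_ind (well_order_wf lambda_wo)): x => x IH xk.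
  have /choice[v vP] : forall y, exists v, y < x ->
      exists2 g, g < kappa & conv y v g.
    move=> y; have [yx|] := ltP y x; last by exists true.
    by have [v vP] := IH y yx (lt_trans yx xk); exists v.
  have [g gk below] : exists2 g, g < kappa & forall y, y < x -> conv y (v y) g.
    apply: (@choose_bounded x (fun y => conv y (v y))) => // y g g' gg' cg z Az g'z.
    by apply: cg => //; apply: le_trans g'z.
  (* Past [g] the rows agree below [x], so a change at [x] decides [lex]: colour true forbids a drop
     from 1 to 0, colour false a rise. The value [c], once taken, persists. *)
  have step z w : A z -> A w -> g <= z -> z < w -> t z x = c -> t w x = c.
    move=> Az Aw gz zw tz.
    have gw : g <= w by apply: le_trans gz (ltW zw).
    have agree y : y < x -> t z y = t w y by move=> yx; rewrite !(below y).
    have := cP (z, w); rewrite /= => /(_ (And3 Az Aw zw)) cE.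
    move: cE tz; case: (c) => cE tz.
      have /asboolP[y /= [ty0 ty1 tyl]] := cE.
      have [yx|xy|<-//] := ltgtP y x.
        by have := agree y yx; rewrite ty0 ty1.
      by rewrite -tyl.
    apply/negP => tw; move/asboolP: cE; apply.
    by exists x; split.
  (* Either [c] is taken at some [z] past [g] and kept from there, or the value is [~~ c] all the
     way from [g]. *)
  have [[z [Az gz tz]]|nex] := pselect (exists z, [/\ A z, g <= z & t z x = c]).
    exists c, z; first exact: Ak.
    move=> w Aw; rewrite le_eqVlt => /predU1P[<-//|zw].
    exact: (step z).
  exists (~~ c), g => // z Az gz.
  have : t z x <> c by move=> tz; apply: nex; exists z.
  by case: (t z x); case: (c).
have /choice[h hP] : forall x, exists v, x < kappa ->
    exists2 g, g < kappa & conv x v g.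
  move=> x; have [xk|] := ltP x kappa; last by exists true.
  by have [v vP] := conv_ex x xk; exists v.
exists A, h; split=> // x xk.
have [g gk gP] : exists2 g, g < kappa & forall y, y < x -> conv y (h y) g.
  apply: (@choose_bounded x (fun y => conv y (h y))) => //.
    by move=> y g g' gg' cg z Az g'z; apply: cg => //; apply: le_trans g'z.
  by move=> y yx; apply: hP; apply: lt_trans xk.
by exists g => // z Az gz y yx; apply: gP.
Qed.

(** * Positive sets and the limit branch [h] *)

Lemma cap_union_lt b : Pkl kappa b -> cap_union kappa b < kappa.
Proof.
move=> [_ small].
have [g gk bg] : exists2 g, g < kappa & forall x, (b `&` segment kappa) x -> x <= g.
  apply: (@small_family_bounded _ (b `&` segment kappa) id).
    by apply: card_le_lt_trans small; apply: subset_card_le => x [].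
  by move=> x [].
apply: le_lt_trans gk; rewrite leNgt; apply/negP => gb.
have : segment (cap_union kappa b) g by [].
rewrite cap_unionE // => -[x bx gx].
by have := lt_le_trans gx (bg x bx); rewrite ltxx.
Qed.

Section Ideal.
Variable H : set (set (set lambda)).
Hypothesis H_ideal : ideal_on_Pkl kappa H.

Lemma ideal_sub A B : H A -> B `<=` A -> H B.
Proof. by have [[_ [_ _ sub _ _]] _ _] := H_ideal; apply: sub. Qed.

Lemma ideal_setU A B : H A -> H B -> H (A `|` B).
Proof. by have [[_ [_ _ _ un _]] _ _] := H_ideal; apply: un. Qed.

(** By fineness: if x < y < kappa, every [b] containing [y] has [cap_union kappa b] above [x], so
    this set misses the cone over {y}. *)
Lemma ideal_cap_union_le x : x < kappa ->
  H [set b | Pkl kappa b /\ cap_union kappa b <= x].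
Proof.
move=> xk; have [_ _ fine] := H_ideal; apply: fine; split; first by move=> b [].
have [y xy yk] := regular_lt_next xk.
have [_ infk _] := kappa_regular.
exists [set y]; first by split=> //; apply: finite_card_lt.
apply/seteqP; split=> // b [[_ bx] [_ yb]].
have : segment (cap_union kappa b) x.
  by rewrite cap_unionE //; exists y => //; split => //; apply: yb.
by rewrite /segment /= ltNge bx.
Qed.

Definition agreeing (F : lambda * set lambda -> bool) (A : set (set lambda))
    (h : lambda -> bool) (x : lambda) : set (set lambda) :=
  [set b | A b /\ forall y, y < x -> F (y, b) = h y].

(** Otherwise, by completeness, fewer than [kappa] classes never cover [A], so recursion yields
    [kappa] many rows differing pairwise below [x]. A convergent subsequence contradicts this. *)
Lemma agreeing_positive F A x : weakly_compact kappa -> x < kappa -> ~ H A ->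
  exists s, ~ H (agreeing F A s x).
Proof.
move=> wc xk nHA; apply: contrapT => /forallNP/(_ _)/contrapT allH.
pose row (b : set lambda) y := F (y, b).
pose differ b b' := exists2 y, y < x & row b y <> row b' y.
have [_ complete _] := H_ideal.
have [z f zk|f fP] := @wf_choice _ _ _ set0 (segment kappa) A differ
  (well_order_wf lambda_wo).
  (* If the choice fails at stage [z], the classes of the earlier [f y] cover [A]. *)
  apply: contrapT => nex; apply: nHA.
  pose classes := [set agreeing F A (row (f y)) x | y in segment z].
  apply: (@ideal_sub (\bigcup_(C in classes) C)).
    apply: complete; first by move=> _ [y _ <-].
    exact: card_le_lt_trans (card_image_le _ _) (segment_card_lt zk).
  move=> b Ab; apply: contrapT => nb; apply: nex; exists b => // y yz.
  apply: contrapT => ndiff; apply: nb.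
  exists (agreeing F A (row (f y)) x); first by exists y.
  split=> // w wx; apply: contrapT => ne; apply: ndiff; exists w => // e.
  exact: ne.
have [B [h [Bk unbB hP]]] := weakly_compact_convergence (fun z => row (f z)) wc.
have [g gk gP] := hP x xk.
have [z Bz gz] := unbB g gk; have [w Bw zw] := unbB z (Bk z Bz).
have [_ /(_ z zw)[y yx]] := fP w (Bk w Bw); apply.
by rewrite !gP // ltW // (lt_trans gz).
Qed.

(** The positive restrictions found for different [x] need not cohere; the limit of a convergent
    subsequence of them does. *)
Lemma agreeing_branch F A : weakly_compact kappa -> ~ H A ->
  exists h, forall x, x < kappa -> ~ H (agreeing F A h x).
Proof.
move=> wc nHA.
have /choice[t tP] : forall x, exists s, x < kappa -> ~ H (agreeing F A s x).
  move=> x; have [xk|] := ltP x kappa; last by exists xpredT.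
  by have [s sP] := agreeing_positive F wc xk nHA; exists s.
have [B [h [Bk unbB hP]]] := weakly_compact_convergence t wc.
exists h => x xk; have [g gk gP] := hP x xk.
(* Past [g], [t z] agrees with [h] below [x]; past [x], agreement with [t z] below [z] includes
   agreement below [x]. *)
have [z Bz gz] : exists2 z, B z & Order.max g x < z.
  by apply: unbB; rewrite gt_max gk.
move: gz; rewrite gt_max => /andP[gz xz].
move=> Hx; apply: (tP z (Bk z Bz)); apply: ideal_sub Hx _ => b [Ab bP].
split=> // y yx; rewrite bP; last exact: lt_trans yx xz.
by apply: gP => //; apply: ltW.
Qed.

(* One of the two halves [h (cap_union b) = i] stays positive along the whole
   decreasing sequence of the sets [agreeing F A h x]. *)
Lemma agreeing_branch_color F A : weakly_compact kappa -> ~ H A ->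
  exists h i, forall x, x < kappa ->
    ~ H [set b | agreeing F A h x b /\ h (cap_union kappa b) = i].
Proof.
move=> wc nHA; have [h hP] := agreeing_branch F wc nHA.
exists h; apply: contrapT => /forallNP nex.
have colorH i : exists2 x, x < kappa &
    H [set b | agreeing F A h x b /\ h (cap_union kappa b) = i].
  apply: contrapT => no; apply: (nex i) => x xk Hx; apply: no.
  by exists x.
have [x xk Hx] := colorH true; have [y yk Hy] := colorH false.
apply: (hP (Order.max x y)); first by rewrite gt_max xk.
apply: ideal_sub (ideal_setU Hx Hy) _ => b [Ab bP].
case E: (h (cap_union kappa b)); [left|right]; split=> //; split=> // z zx;
  by apply: bP; rewrite lt_max zx ?orbT.
Qed.

End Ideal.

(** * Homogeneous sets from points of the space of functions from [kappa] to 2 *)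

Notation K := (set_type (segment kappa)).

Definition point (x : lambda) (xk : segment kappa x) : K := SigSub (mem_set xk).

Lemma card_K : [set: K] #= segment kappa.
Proof. exact: card_setT. Qed.

Lemma small_K_bounded (a : set K) : small_subsets [set: K] [set: K] a ->
  exists2 g, g < kappa & forall k, a k -> val k <= g.
Proof.
move=> [_ small]; apply: small_family_bounded.
  by apply: card_lt_le_trans small _; rewrite (card_le_eql card_K).
by move=> k _; apply: (set_valP k).
Qed.

Lemma small_K_initial x : x < kappa ->
  small_subsets [set: K] [set: K] [set k | val k <= x].
Proof.
move=> xk; split=> //.
apply: (@card_lt_le_trans _ _ _ _ (segment kappa)); last first.
  by rewrite (card_le_eqr card_K).
apply: card_le_lt_trans (initial_card_lt xk).
have /card_eqPle[_ le_image] := inj_card_eq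
  (in2W val_inj : {in [set k : K | val k <= x] &, injective (val : K -> lambda)}).
by apply: card_le_trans le_image _; apply: subset_card_le => _ [k kx <-].
Qed.

(* For Cohen generic [g] this is the required homogeneous set. *)
Definition generic_set (F : lambda * set lambda -> bool) (A : set (set lambda))
    (h : lambda -> bool) (i : bool) (g : K -> bool) : set (set lambda) :=
  [set b | [/\ A b, h (cap_union kappa b) = i,
    exists2 k, val k = cap_union kappa b & g k &
    forall k, val k < cap_union kappa b -> g k -> h (val k) = i ->
      F (val k, b) = i]].

(** Membership of [a] makes [cap_union kappa a] one of the points [k] to which the last clause for
    [b] applies. *)
Lemma generic_set_homogeneous F A h i g :
  constant_on (kpairs kappa (generic_set F A h i g)) F.
Proof.
exists i => _ [a [b [[_ ha [k kE gk] _] [_ _ _ bP] ab ->]]].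
by rewrite -kE; apply: bP => //; rewrite kE.
Qed.

(** Membership of a fixed [b] depends only on [g] at the points up to and including
    [cap_union kappa b], an initial segment of size below [kappa]. *)
Lemma generic_set_open F A h i D :
  box_open K [set g | exists2 b, Pkl kappa b & generic_set F A h i g b /\ ~ D b].
Proof.
apply: basic_nbhd_open => g [b Pb [[Ab hb [k kE gk] bP] nDb]].
exists [set k | val k <= cap_union kappa b].
  by apply: small_K_initial; apply: cap_union_lt.
move=> f fg; exists b => //; split=> //; split=> //.
  by exists k => //; rewrite fg //= kE.
by move=> l lb fl; apply: bP => //; rewrite -fg //= ltW.
Qed.

(** A condition [s] on [a], bounded by [x], is extended to put into the generic set some [b] outside
    [D] that follows [h] below [x]. *)
Lemma generic_set_dense (H : set (set (set lambda))) F A h i D :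
  ideal_on_Pkl kappa H -> A `<=` Pkl kappa -> H D ->
  (forall x, x < kappa ->
    ~ H [set b | agreeing F A h x b /\ h (cap_union kappa b) = i]) ->
  box_dense [set g | exists2 b, Pkl kappa b & generic_set F A h i g b /\ ~ D b].
Proof.
move=> H_ideal AP HD hP; apply: basic_nbhd_dense => a s small.
have [x0 x0k ax0] := small_K_bounded small.
have [x x0x xk] := regular_lt_next x0k.
have [b [[Ab bP] hb nDb xb]] : exists b, [/\ agreeing F A h x b,
    h (cap_union kappa b) = i, ~ D b & x < cap_union kappa b].
  apply: contrapT => nex; apply: (hP x xk).
  (* Removing [D] and the [b] with [cap_union kappa b] at most [x] cannot exhaust a positive set. *)
  have HDx := ideal_setU H_ideal HD (ideal_cap_union_le H_ideal xk).
  apply: (ideal_sub H_ideal) HDx _.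
  move=> b [Ab hb]; have [Db|nDb] := pselect (D b); [by left | right].
  split; first by apply: AP; case: Ab.
  by rewrite leNgt; apply/negP => xb; apply: nex; exists b.
have Pb := AP b Ab.
have ax k : a k -> val k < x by move=> ak; apply: le_lt_trans (ax0 k ak) x0x.
(* Outside [a], only [cap_union kappa b] gets value 1. So each [k] to be checked for [b] lies in
   [a], where F(k, b) = h(k) = i. *)
pose g k := if `[< a k >] then s k else val k == cap_union kappa b.
exists g; split.
  by move=> k ak; rewrite /g asboolT.
exists b => //; split=> //; split=> //.
  exists (point (cap_union_lt Pb)) => //; rewrite /g asboolF ?eqxx // => /ax /=.
  by rewrite ltNge (ltW xb).
move=> k kb gk hk; rewrite -hk; apply: bP; apply: ax.
apply: contrapT => nak; move: gk; rewrite /g asboolF // => /eqP kE.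
by rewrite kE ltxx in kb.
Qed.

End RegularCardinal.

Theorem theorem13p1 (d : Order.disp_t) (lambda : orderType d) (kappa : lambda)
  (lambda_wo : well_order (<=%O : rel lambda))
  (lambda_card : is_cardinal [set: lambda])
  (kappa_regular : regular_cardinal kappa)
  (kappa_uncountable : ~ countable (segment kappa))
  (kappa_wc : weakly_compact kappa)
  (H : set (set (set lambda)))
  (H_ideal : ideal_on_Pkl kappa H)
  (cof_lt_cov : least_card_lt (cofinal_families H)
                              (meager_covers (set_type (segment kappa)))) :
  kappa_arrow kappa H.
Proof.
move=> F A [AP nHA]; have [X [Y [[[XH HX] _] covY XY]]] := cof_lt_cov.
have [h [i hP]] := agreeing_branch_color lambda_wo kappa_regular H_ideal F
  kappa_wc nHA.
have [x0 x0k] : segment kappa !=set0.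
  by have [_ infk _] := kappa_regular; apply: infinite_setN0.
(* One [g] meets the dense open sets of all [D] in the cofinal family [X]. *)
have [g gP] := open_dense_bigcap_nonempty (point x0k) covY XY
  (fun D XD => conj (generic_set_open lambda_wo kappa_regular F A h i D)
     (generic_set_dense lambda_wo kappa_regular H_ideal AP (XH D XD) hP)).
exists (generic_set F A h i g); split; last exact: generic_set_homogeneous.
  split; first by move=> b [/AP].
  (* Were the generic set in [H], some [D] in [X] would include it, against the choice of [g]. *)
  rewrite /= HX => -[D XD BD].
  by have [b _ [Bb nDb]] := gP D XD; apply: nDb; apply: BD.
by move=> b [].
Qed.
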